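(* Let $X$ be a set and let $\mathbf{S}\le(\mathrm{End}(X),\circ)$ be a transformation semigroup over $X$. Then the function $k\colon \mathrm{Iso}(\epsilon_{\mathbf{S}},\circ_{\mathbf{S}})\to\mathcal{S}(\mathbf{S})$ sending $\phi$ to the set $X$ equipped with the multiplication $x\cdot y=\phi(x)(y)$ is (well defined and) a bijection.
   Context: For a set $X$, $\mathrm{End}(X)$ is the set of all functions $X\to X$; a transformation semigroup over $X$ is a subsemigroup $\mathbf{S}$ (with underlying set $S$) of $(\mathrm{End}(X),\circ)$. There are two canonical $\mathbf{S}$-actions: $\epsilon_{\mathbf{S}}\colon S\times X\to X$, $(f,x)\mapsto f(x)$, and $\circ_{\mathbf{S}}\colon S\times S\to S$, $(f,g)\mapsto f\circ g$. $\mathrm{Iso}(\epsilon_{\mathbf{S}},\circ_{\mathbf{S}})$ is the set of bijections $\phi\colon X\to S$ with $\phi(f(x))=f\circ\phi(x)$ for all $f\in S$, $x\in X$. For a semigroup $\mathbf{X}=(X,\cdot)$ the representing map is $\phi_{\mathbf{X}}\colon X\to\mathrm{End}(X)$, $\phi_{\mathbf{X}}(x)(y)=x\cdot y$, and its image is called the representation of $\mathbf{X}$; $\mathbf{X}$ is faithful if $\phi_{\mathbf{X}}$ is injective. Convention: ''representation'' means faithful representation, so $\mathcal{S}(\mathbf{S})$, the set of unrepresentations of $\mathbf{S}$, is the set of all faithful semigroups with underlying set $X$ whose representation (image of the representing map) is $\mathbf{S}$. *)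

(* Defs.v *)
From mathcomp Require Import all_boot.
From mathcomp Require Import boolp classical_sets functions.

Set Implicit Arguments.
Unset Strict Implicit.
Unset Printing Implicit Defensive.

Local Open Scope classical_set_scope.

(* The empty subsemigroup is allowed, and so is an empty X. *)
Record transformation_semigroup (X : Type) := TransformationSemigroup {
  transformations :> set (X -> X);
  transformations_comp : forall f g : X -> X,
    transformations f -> transformations g -> transformations (f \o g) }.

(* For S : transformation_semigroup X, the underlying set S as a type is
   set_type S, with injection val : set_type S -> X -> X. *)

Definition eval_action (X : Type) (S : transformation_semigroup X)
  (f : set_type S) (x : X) : X := val f x.

Definition comp_action (X : Type) (S : transformation_semigroup X)
  (f g : set_type S) : set_type S :=
  SigSub (mem_set (transformations_comp (set_valP f) (set_valP g))).

(* Curried maps A -> Y -> Y stand for the functions A * Y -> Y. *)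
Definition action_iso (A Y Z : Type) (alpha : A -> Y -> Y)
  (beta : A -> Z -> Z) : set (Y -> Z) :=
  [set phi | bijective phi /\
             forall (a : A) (y : Y), phi (alpha a y) = beta a (phi y)].

(* A semigroup with underlying set X is given by an associative operation. *)
Definition representing_map (X : Type) (op : X -> X -> X) : X -> (X -> X) :=
  fun x => (fun y => op x y).

Definition representation (X : Type) (op : X -> X -> X) : set (X -> X) :=
  range (representing_map op).

Definition faithful (X : Type) (op : X -> X -> X) : Prop :=
  injective (representing_map op).

Definition unrepresentations (X : Type) (S : transformation_semigroup X) :
  set (X -> X -> X) :=
  [set op | [/\ associative op, faithful op &
               representation op = transformations S]].

Definition iso_mul (X : Type) (S : transformation_semigroup X)
  (phi : X -> set_type S) : X -> X -> X := fun x y => val (phi x) y.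

(* Main.v *)
Require Import Defs.
From mathcomp Require Import all_boot.
From mathcomp Require Import boolp classical_sets functions.

Local Open Scope classical_set_scope.

(** The representing map of [iso_mul phi] is [phi] followed by the inclusion of [S] in [X -> X]. So
    [phi] is injective iff the product is faithful, and onto iff its representation is [S]. Every
    [f] in [S] then has the form [phi x], and equivariance at [phi x] is associativity:
    [phi (phi x y) = phi x \o phi y]. Hence the inverse of [iso_mul] sends a product to its
    representing map, corestricted to [S]; [unrepresentation_iso_mul] gives surjectivity this
    way. *)

Lemma iso_mul_unrepresentation (X : Type) (S : transformation_semigroup X)
    (phi : X -> set_type S) :
  action_iso (@eval_action X S) (@comp_action X S) phi ->
  unrepresentations S (iso_mul phi).
Proof.
move=> [phi_bij phi_iso]; split.
- move=> x y z.
  (* Equivariance for [f = phi x], evaluated at [z], reads [(x y) z = x (y z)]. *)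
  have /(congr1 val)/(congr1 (fun f => f z)) := phi_iso (phi x) y.
  exact: esym.
- by move=> x y op_eq; apply: (bij_inj phi_bij); apply: val_inj.
- apply/seteqP; split=> [_ [x _ <-]|f Sf]; first exact: (set_valP (phi x)).
  have [psi _ psiK] := phi_bij.
  by exists (psi (SigSub (mem_set Sf))) => //;
  rewrite /representing_map /iso_mul psiK.
Qed.

Lemma unrepresentation_iso_mul (X : Type) (S : transformation_semigroup X)
    (op : X -> X -> X) :
  unrepresentations S op ->
  exists2 phi, action_iso (@eval_action X S) (@comp_action X S) phi &
    iso_mul phi = op.
Proof.
move=> [opA op_inj op_rep].
have Sop x : transformations S (op x) by rewrite -op_rep; exists x.
have op_onto (f : set_type S) : exists x, op x = val f.
  have /(_ _ (set_valP f)) [x _ opx] : transformations S `<=` representation op.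
    by rewrite op_rep.
  by exists x.
exists (fun x => SigSub (mem_set (Sop x))) => //; split.
- rewrite -setTT_bijective; split=> // [x y _ _ /(congr1 val) /op_inj //|f _].
  by have [x opx] := op_onto f; exists x => //; apply: val_inj.
- move=> f x; apply: val_inj => /=; apply/funext => y.
  (* As [f] is left multiplication by some [z], the goal becomes [(z x) y = z (x y)]. *)
  by have [z opz] := op_onto f; rewrite /eval_action /= -opz opA.
Qed.

(* set_bij A B k: k maps A into B, is injective on A, and is onto B. *)
Theorem corollary3p2 (X : Type) (S : transformation_semigroup X) :
  set_bij (action_iso (@eval_action X S) (@comp_action X S))
          (unrepresentations S)
          (@iso_mul X S).
Proof.
split=> [phi|phi psi _ _ mul_eq|op /unrepresentation_iso_mul //].
- exact: iso_mul_unrepresentation.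
(* The rows [y |-> x y] of the product determine each [phi x]. *)
- by apply/funext => x; apply: val_inj; exact: (congr1 (fun op => op x) mul_eq).
Qed.
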